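(* Let $n,p$ be positive integers, let $(\phi_k)_{k=0}^\infty\subset\mathbb{R}^{p\times n}$ be persistently exciting, let $R\in\mathbb{R}^{n\times n}$ be positive definite, define $P_0=R^{-1}$, let $\lambda\in(0,1]$, and, for all $k\ge 0$, let $P_{k+1}$ be given by $$P_{k+1}=\frac1\lambda P_k-\frac1\lambda P_k\phi_k^{\mathrm T}\left(\lambda I_p+\phi_kP_k\phi_k^{\mathrm T}\right)^{-1}\phi_kP_k .$$ Consider the linear time-varying system on $\mathbb{R}^n$ $$\tilde\theta_{k+1}=(I_n-P_{k+1}\phi_k^{\mathrm T}\phi_k)\tilde\theta_k,\qquad k\ge 0 .$$ Then the zero solution of this system is Lyapunov stable. In addition, if $\lambda\in(0,1)$, then the zero solution of this system is uniformly Lyapunov stable and uniformly globally geometrically stable.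
   Context: Matrix inequalities are in the sense of symmetric matrices ($A\le B$ means $B-A$ is positive semidefinite); positive definite matrices are real symmetric; $\|\cdot\|$ is the Euclidean norm. Persistent excitation: a sequence $(\phi_k)_{k=0}^\infty\subset\mathbb{R}^{p\times n}$ is persistently exciting if there exist an integer $N\ge n/p$ and $\alpha,\beta\in(0,\infty)$ such that, for all $j\ge0$, $\alpha I_n\le\sum_{i=j}^{j+N}\phi_i^{\mathrm T}\phi_i\le\beta I_n$. Stability definitions, for a system $x_{k+1}=f(k,x_k)$ with $x_k\in\mathbb{R}^n$, $f$ continuous, and $f(k,0)=0$ for all $k\ge0$: (i) The zero solution is Lyapunov stable if, for all $\varepsilon>0$ and $k_0\ge0$, there exists $\delta(\varepsilon,k_0)>0$ such that, for all $x_{k_0}\in\mathbb{R}^n$ with $\|x_{k_0}\|<\delta(\varepsilon,k_0)$, it holds that $\|x_k\|<\varepsilon$ for all $k\ge k_0$. (ii) The zero solution is uniformly Lyapunov stable if, for all $\varepsilon>0$, there exists $\delta(\varepsilon)>0$ such that, for all $k_0\ge0$ and all $x_{k_0}\in\mathbb{R}^n$ with $\|x_{k_0}\|<\delta(\varepsilon)$, it holds that $\|x_k\|<\varepsilon$ for all $k\ge k_0$. (iii) The zero solution is uniformly globally geometrically stable if there exist $a>0$ and $b>1$ such that, for all $k_0\ge0$ and all $x_{k_0}\in\mathbb{R}^n$, it holds that $\|x_k\|\le a\|x_{k_0}\|b^{-(k-k_0)}$ for all $k\ge k_0$. *)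

(* Defs.v *)
From HB Require Import structures.
From mathcomp Require Import all_boot all_order all_algebra.
From mathcomp Require Import reals.

Set Implicit Arguments.
Unset Strict Implicit.
Unset Printing Implicit Defensive.

Import Order.TTheory GRing.Theory Num.Theory.

Local Open Scope ring_scope.

Section Definitions.
Variable K : realType.

Definition eucl_norm n (x : 'cV[K]_n) : K := Num.sqrt (\sum_(i < n) x i 0 ^+ 2).

Definition possemidefmx n (A : 'M[K]_n) : Prop :=
  A \is symmetricmx /\ forall x : 'cV[K]_n, 0 <= (x^T *m A *m x) 0 0.

Definition posdefmx n (A : 'M[K]_n) : Prop :=
  A \is symmetricmx /\
  forall x : 'cV[K]_n, x != 0 -> 0 < (x^T *m A *m x) 0 0.

Definition loewner_le n (A B : 'M[K]_n) : Prop := possemidefmx (B - A).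

Definition persistently_exciting p n (phi : nat -> 'M[K]_(p, n)) : Prop :=
  exists (N : nat) (alpha beta : K),
    [/\ n%:R / p%:R <= N%:R :> K, 0 < alpha, 0 < beta &
      forall j : nat,
        let S := \sum_(j <= i < (j + N).+1) (phi i)^T *m phi i in
        loewner_le alpha%:M S /\ loewner_le S beta%:M].

(* The time-varying system x_(k+1) = f k (x_k) is represented by [f]. A
   trajectory started at time k0 is a sequence on nat of which only the terms
   of index at least k0 are relevant. *)
Definition trajectory n (f : nat -> 'cV[K]_n -> 'cV[K]_n) (k0 : nat)
    (x : nat -> 'cV[K]_n) : Prop :=
  forall k : nat, (k0 <= k)%N -> x k.+1 = f k (x k).

Definition lyapunov_stable n (f : nat -> 'cV[K]_n -> 'cV[K]_n) : Prop :=
  forall (eps : K) (k0 : nat), 0 < eps ->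
  exists2 delta : K, 0 < delta &
    forall x, trajectory f k0 x -> eucl_norm (x k0) < delta ->
    forall k, (k0 <= k)%N -> eucl_norm (x k) < eps.

Definition uniformly_lyapunov_stable n
    (f : nat -> 'cV[K]_n -> 'cV[K]_n) : Prop :=
  forall eps : K, 0 < eps ->
  exists2 delta : K, 0 < delta &
    forall k0 x, trajectory f k0 x -> eucl_norm (x k0) < delta ->
    forall k, (k0 <= k)%N -> eucl_norm (x k) < eps.

Definition uniformly_globally_geometrically_stable n
    (f : nat -> 'cV[K]_n -> 'cV[K]_n) : Prop :=
  exists a b : K, [/\ 0 < a, 1 < b &
    forall k0 x, trajectory f k0 x ->
    forall k, (k0 <= k)%N ->
      eucl_norm (x k) <= a * eucl_norm (x k0) * b ^- (k - k0)].

End Definitions.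

(* Main.v *)
Require Import Defs.
From HB Require Import structures.
From mathcomp Require Import all_boot all_order all_algebra.
From mathcomp Require Import reals.
From mathcomp Require Import ring lra.

Set Implicit Arguments.
Unset Strict Implicit.
Unset Printing Implicit Defensive.

Import Order.TTheory GRing.Theory Num.Theory.

Local Open Scope ring_scope.

(** The Riccati-like recursion for P is the matrix inversion lemma in disguise:
    its inverse Q_k (the information matrix) obeys the linear recursion
    Q_(k+1) = lambda Q_k + phi_k^T phi_k with Q_0 = R ([cov_info]).
    Multiplying the system by Q_(k+1) gives Q_(k+1) x_(k+1) = lambda Q_k x_k,
    and from this the quadratic form V_k = x_k^T Q_k x_k satisfies
    V_(k+1) <= lambda V_k ([energy_step]).

    It remains to compare V_k with |x_k|^2.  Below, V_k >= c |x_k|^2 with c > 0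
    independent of k, for every lambda in (0, 1]: over the last N + 1 steps the
    regressors contribute at least lambda^(N+1) alpha, and before time N + 1
    the initial matrix R has been discounted by at most lambda^(N+1)
    ([info_ge]).  Above, each fixed Q_k is bounded, which already gives Lyapunov
    stability; when lambda < 1 persistent excitation gives
    phi_k^T phi_k <= beta, so Q_(k+1) <= lambda Q_k + beta keeps Q_k below a
    constant M independent of k ([info_le]).  Then
    c |x_k|^2 <= V_k <= lambda^(k-k0) V_k0 <= lambda^(k-k0) M |x_k0|^2,
    which is geometric decay at rate sqrt lambda, and uniform Lyapunov stability
    follows. *)

(** * Quadratic forms *)

Section QuadraticForms.
Variable K : realType.

Definition bform m n (A : 'M[K]_(m, n)) (x : 'cV[K]_m) (y : 'cV[K]_n) : K :=
  (x^T *m A *m y) 0 0.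

Definition qform n (A : 'M[K]_n) (x : 'cV[K]_n) : K := bform A x x.

Definition normsq n (x : 'cV[K]_n) : K := (x^T *m x) 0 0.

Lemma normsqE n (x : 'cV[K]_n) : normsq x = \sum_(i < n) x i 0 ^+ 2.
Proof.
by rewrite /normsq mxE; apply: eq_bigr => i _; rewrite !mxE expr2.
Qed.

Lemma normsq_ge0 n (x : 'cV[K]_n) : 0 <= normsq x.
Proof. by rewrite normsqE sumr_ge0 // => i _; rewrite sqr_ge0. Qed.

Lemma normsq_gt0 n (x : 'cV[K]_n) : x != 0 -> 0 < normsq x.
Proof.
rewrite lt0r normsq_ge0 andbT; apply: contra => /eqP x0.
apply/eqP/colP => i; rewrite mxE; apply/eqP.
move/eqP: x0; rewrite normsqE psumr_eq0 => [/allP/(_ i)|j _]; last exact: sqr_ge0.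
by rewrite mem_index_enum sqrf_eq0 => /(_ isT).
Qed.

Lemma sqrtrX (a : K) m : 0 <= a -> Num.sqrt (a ^+ m) = Num.sqrt a ^+ m.
Proof.
move=> a0; elim: m => [|m IH]; first by rewrite !expr0 sqrtr1.
by rewrite !exprS sqrtrM // IH.
Qed.

Lemma eucl_normE n (x : 'cV[K]_n) : eucl_norm x = Num.sqrt (normsq x).
Proof. by rewrite normsqE. Qed.

Lemma qformD n (A B : 'M[K]_n) x : qform (A + B) x = qform A x + qform B x.
Proof. by rewrite /qform /bform mulmxDr mulmxDl mxE. Qed.

Lemma qformB n (A B : 'M[K]_n) x : qform (A - B) x = qform A x - qform B x.
Proof. by rewrite /qform /bform mulmxBr mulmxBl !mxE. Qed.

Lemma loewner_le_qform n (A B : 'M[K]_n) :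
  loewner_le A B -> forall x, qform A x <= qform B x.
Proof. by move=> [_ AB] x; rewrite -subr_ge0 -qformB; apply: AB. Qed.

Lemma qformZ n (a : K) (A : 'M[K]_n) x : qform (a *: A) x = a * qform A x.
Proof. by rewrite /qform /bform -scalemxAr -scalemxAl mxE. Qed.

Lemma qform_scalar n (a : K) (x : 'cV[K]_n) : qform a%:M x = a * normsq x.
Proof. by rewrite /qform /bform mul_mx_scalar -scalemxAl mxE. Qed.

Lemma qform_sum n (I : Type) (r : seq I) (F : I -> 'M[K]_n) x :
  qform (\sum_(i <- r) F i) x = \sum_(i <- r) qform (F i) x.
Proof. by rewrite /qform /bform mulmx_sumr mulmx_suml summxE. Qed.

Lemma qform_congr m n (B : 'M[K]_(m, n)) (A : 'M[K]_m) x :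
  qform (B^T *m A *m B) x = qform A (B *m x).
Proof. by rewrite /qform /bform trmx_mul !mulmxA. Qed.

Lemma qform_gram m n (B : 'M[K]_(m, n)) x :
  qform (B^T *m B) x = normsq (B *m x).
Proof. by rewrite /qform /bform /normsq trmx_mul !mulmxA. Qed.

Lemma symmetricmxP n (A : 'M[K]_n) : reflect (A^T = A) (A \is symmetricmx).
Proof.
rewrite is_hermitianmxE expr0 scale1r map_mx_id // eq_sym.
exact: eqP.
Qed.

Lemma bform_tr m n (A : 'M[K]_(m, n)) x y : bform A x y = bform A^T y x.
Proof.
rewrite /bform -[in RHS](trmxK y) -[in RHS](trmxK x).
by rewrite -!trmx_mul mulmxA [RHS]mxE trmxK.
Qed.

Lemma qform_scale_sub n (A : 'M[K]_n) (t : K) x y : A^T = A ->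
  qform A (t *: x - y) = t ^+ 2 * qform A x - 2 * t * bform A x y + qform A y.
Proof.
move=> AT; have byx : bform A y x = bform A x y by rewrite bform_tr AT.
suff -> : qform A (t *: x - y) =
    t * (t * qform A x) - t * bform A x y - (t * bform A y x - qform A y).
  by rewrite byx; ring.
have xyT : (t *: x - y)^T = t *: x^T - y^T by rewrite linearB linearZ.
rewrite /qform /bform xyT !mulmxBl !mulmxBr.
by rewrite -!scalemxAl -!scalemxAr !mxE.
Qed.

Lemma posdefmx_unit n (A : 'M[K]_n) :
  (forall x : 'cV[K]_n, x != 0 -> 0 < qform A x) -> A \in unitmx.
Proof.
move=> Apos; rewrite -row_free_unit -kermx_eq0; apply/eqP/row_matrixP => i.
rewrite row0; apply/eqP/negP => /negP u0.
have uA : row i (kermx A) *m A = 0 by rewrite -row_mul mulmx_ker row0.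
have /Apos : (row i (kermx A))^T != 0 by rewrite trmx_eq0.
by rewrite /qform /bform trmxK uA mul0mx mxE ltxx.
Qed.

Lemma posdefmx_ge0 n (A : 'M[K]_n) x : posdefmx A -> 0 <= qform A x.
Proof.
case=> _ Apos; have [->|/Apos/ltW //] := eqVneq x 0.
by rewrite /qform /bform mulmx0 mxE.
Qed.

Lemma posdefmx_inv_ge0 n (A P : 'M[K]_n) x :
  posdefmx A -> P *m A = 1%:M -> 0 <= qform P x.
Proof.
move=> Apd PA; have AP := mulmx1C PA; have [/symmetricmxP AT _] := Apd.
suff -> : qform P x = qform A (P *m x) by exact: posdefmx_ge0.
rewrite -qform_congr.
by rewrite -AT -trmx_mul AP trmx1 mul1mx.
Qed.

(** Each product of coordinates is at most the squared norm, so the sum of the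
    absolute values of the entries serves as a bound. *)
Lemma qform_le_normsq n (A : 'M[K]_n) :
  exists2 M : K, 0 < M & forall x, qform A x <= M * normsq x.
Proof.
exists (1 + \sum_i \sum_j `|A i j|) => [|x].
  by rewrite ltr_pwDl // !sumr_ge0 // => i _; rewrite sumr_ge0.
have coord_le i : x i 0 ^+ 2 <= normsq x.
  by rewrite normsqE (bigD1 i) //= lerDl sumr_ge0 // => j _; rewrite sqr_ge0.
rewrite mulrDl mul1r -[leLHS]add0r lerD ?normsq_ge0 //.
rewrite /qform /bform mxE mulr_suml [leRHS](eq_bigr _ (fun i _ => mulr_suml _ _ _ _)).
rewrite exchange_big /=; apply: ler_sum => j _.
rewrite mxE mulr_suml; apply: ler_sum => i _; rewrite mxE.
have -> : x i 0 * A i j * x j 0 = A i j * (x i 0 * x j 0) by ring.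
apply: le_trans (ler_norm _) _; rewrite normrM ler_wpM2l //.
have := coord_le i; have := coord_le j.
by rewrite ler_norml; set s := normsq x => h1 h2; apply/andP; split; nra.
Qed.

(** The coercivity constant is the reciprocal of an upper bound M of A^-1.  With
    P = A^-1 and A[x] the quadratic form of A, expanding 0 <= P[x / M - A x]
    gives 2 |x|^2 / M <= A[x] + P[x] / M^2 <= A[x] + |x|^2 / M.  This avoids a
    compactness argument on the unit sphere. *)
Lemma posdefmx_coercive n (A : 'M[K]_n) : posdefmx A ->
  exists2 r : K, 0 < r & forall x, r * normsq x <= qform A x.
Proof.
move=> Apd; have [/symmetricmxP AT Apos] := Apd.
have Au : A \in unitmx by apply: posdefmx_unit.
have [M M0 leM] := qform_le_normsq (invmx A).
exists M^-1 => [|x]; first by rewrite invr_gt0.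
have PT : (invmx A)^T = invmx A by rewrite trmx_inv AT.
have := posdefmx_inv_ge0 (M^-1 *: x - A *m x) Apd (mulVmx Au).
rewrite (qform_scale_sub _ _ _ PT).
have -> : bform (invmx A) x (A *m x) = normsq x.
  by rewrite /bform -mulmxA mulKmx.
have -> : qform (invmx A) (A *m x) = qform A x.
  by rewrite -qform_congr AT mulmxV // mul1mx.
have : M^-1 ^+ 2 * qform (invmx A) x <= M^-1 * normsq x.
  rewrite expr2 -mulrA ler_pM2l ?invr_gt0 //.
  by rewrite mulrC ler_pdivrMr // mulrC.
rewrite -[2 * _ * _]mulrA.
move: (_ * qform _ _) (_ * normsq _) (qform A x) => a b q; lra.
Qed.

End QuadraticForms.

(** * The information matrix *)

Section Information.
Variables (K : realType) (n p : nat).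
Variables (phi : nat -> 'M[K]_(p, n)) (R : 'M[K]_n) (lambda : K).
Hypotheses (R_posdef : posdefmx R).
Hypotheses (lambda_gt0 : 0 < lambda) (lambda_le1 : lambda <= 1).

Fixpoint info (k : nat) : 'M[K]_n :=
  if k is k'.+1 then lambda *: info k' + (phi k')^T *m phi k' else R.

Lemma qform_infoS k x :
  qform (info k.+1) x = lambda * qform (info k) x + normsq (phi k *m x).
Proof. by rewrite qformD qformZ qform_gram. Qed.

Lemma info_posdef k : posdefmx (info k).
Proof.
elim: k => //= k [/symmetricmxP IHT IHpos]; split.
  by apply/symmetricmxP; rewrite linearD linearZ /= IHT trmx_mul trmxK.
move=> x x0; have := qform_infoS k x; rewrite /qform /bform /= => ->.
by rewrite ltr_pwDl ?normsq_ge0 // mulr_gt0 // IHpos.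
Qed.

(** One step of the matrix inversion (Woodbury) lemma.  Writing
    F P F^T = L - lambda turns the gain term times the new information matrix
    into P F^T F, which is what P (lambda Q + F^T F) has beyond lambda. *)
Lemma cov_infoS (P Q : 'M[K]_n) (F : 'M[K]_(p, n)) :
    posdefmx Q -> P *m Q = 1%:M ->
  (lambda^-1 *: P - lambda^-1 *: (P *m F^T *m invmx (lambda%:M + F *m P *m F^T)
     *m F *m P)) *m (lambda *: Q + F^T *m F) = 1%:M.
Proof.
move=> Qpd PQ; set L := lambda%:M + _; have l0 : lambda != 0 by rewrite gt_eqF.
have Lu : L \in unitmx.
  apply: posdefmx_unit => y y0; rewrite qformD qform_scalar.
  rewrite ltr_pwDl ?mulr_gt0 ?normsq_gt0 //.
  by rewrite -[F in F *m P]trmxK qform_congr; apply: posdefmx_inv_ge0 PQ.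
have gainE : P *m F^T *m invmx L *m F *m P *m (lambda *: Q + F^T *m F)
    = P *m F^T *m F.
  rewrite mulmxDr -scalemxAr -[_ *m P *m Q]mulmxA PQ mulmx1.
  have -> : P *m F^T *m invmx L *m F *m P *m (F^T *m F)
      = P *m F^T *m invmx L *m (F *m P *m F^T) *m F by rewrite !mulmxA.
  rewrite -[F *m P *m F^T](addKr lambda%:M) -/L mulmxDr mulmxDl.
  rewrite mulmxKV // mulmxN mul_mx_scalar mulNmx -scalemxAl.
  by rewrite addrA subrr add0r.
rewrite -scalerBr -scalemxAl mulmxBl gainE mulmxDr -scalemxAr PQ mulmxA addrK.
by rewrite scalerA mulVf // scale1r.
Qed.

Lemma cov_info (P : nat -> 'M[K]_n) :
    P 0%N = invmx R ->
    (forall k : nat,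
       P k.+1 = lambda^-1 *: P k
                - lambda^-1 *: (P k *m (phi k)^T
                    *m invmx (lambda%:M + phi k *m P k *m (phi k)^T)
                    *m phi k *m P k)) ->
  forall k, P k *m info k = 1%:M.
Proof.
move=> P0 PS; elim=> [|k IH] /=.
  by rewrite P0 mulVmx // posdefmx_unit //; case: R_posdef.
by rewrite PS; apply: cov_infoS IH; apply: info_posdef.
Qed.

(** The new state x' satisfies Q_(k+1) x' = lambda Q_k x, so its energy is
    lambda times the Q_k-pairing of x' with x.  Expanding
    0 <= Q_k[x' - x] and using lambda Q_k <= Q_(k+1) yields the claim. *)
Lemma energy_step (P : 'M[K]_n) k x :
    P *m info k.+1 = 1%:M ->
  qform (info k.+1) ((1%:M - P *m (phi k)^T *m phi k) *m x)
    <= lambda * qform (info k) x.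
Proof.
move=> PQ; have QP := mulmx1C PQ; set x' := _ *m x.
have [/symmetricmxP QT _] := info_posdef k.
have Qx' : info k.+1 *m x' = lambda *: (info k *m x).
  rewrite /x' mulmxA mulmxBr mulmx1 !mulmxA QP mul1mx /=.
  by rewrite addrK scalemxAl.
have V' : qform (info k.+1) x' = lambda * bform (info k) x' x.
  by rewrite /qform /bform -mulmxA Qx' -scalemxAr mxE mulmxA.
have := posdefmx_ge0 (1 *: x' - x) (info_posdef k).
rewrite (qform_scale_sub _ _ _ QT) => /(mulr_ge0 (ltW lambda_gt0)).
have := qform_infoS k x'; have := normsq_ge0 (phi k *m x').
by move: V'; move: (normsq (phi k *m x')) => s -> s0 E; move: E s0; nra.
Qed.

(** Among the last m steps no term is discounted by more than lambda^m, as
    lambda <= 1. *)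
Lemma info_discount j m x :
  lambda ^+ m * (qform (info j) x + \sum_(j <= i < j + m) normsq (phi i *m x))
    <= qform (info (j + m)) x.
Proof.
elim: m => [|m IH]; first by rewrite addn0 big_geq // addr0 expr0 mul1r.
rewrite addnS qform_infoS big_nat_recr ?leq_addr //= addrA mulrDr.
apply: lerD; first by rewrite exprS -mulrA ler_pM2l.
by rewrite ler_piMl ?normsq_ge0 // exprn_ile1 // ltW.
Qed.

Lemma info_ge : persistently_exciting phi ->
  exists2 c : K, 0 < c & forall k x, c * normsq x <= qform (info k) x.
Proof.
case=> N [alpha [beta [_ alpha0 _ PE]]].
have [r r0 rR] := posdefmx_coercive R_posdef.
pose d := Num.min r alpha; have d0 : 0 < d by rewrite lt_min r0.
have dr : d <= r by rewrite ge_min lexx.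
have dalpha : d <= alpha by rewrite ge_min lexx orbT.
exists (lambda ^+ N.+1 * d) => [|k x]; first by rewrite mulr_gt0 ?exprn_gt0.
have lX m : 0 <= lambda ^+ m by rewrite exprn_ge0 // ltW.
rewrite -mulrA; have [kN|Nk] := leqP k N.+1.
  (* Start-up phase: fewer than N + 1 regressors are available, R suffices. *)
  apply: le_trans (info_discount 0 k x); apply: ler_pM => //.
  - by rewrite mulr_ge0 ?normsq_ge0 // ltW.
  - by rewrite ler_wiXn2l // ltW.
  apply: (le_trans (ler_wpM2r (normsq_ge0 x) dr)).
  apply: le_trans (rR x) _.
  by rewrite lerDl sumr_ge0 // => i _; rewrite normsq_ge0.
(* Otherwise the last N + 1 regressors form a full excitation window. *)
rewrite -(subnK (ltnW Nk)); set j := (k - _)%N.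
apply: le_trans (info_discount j N.+1 x); rewrite ler_wpM2l //.
apply: (le_trans (ler_wpM2r (normsq_ge0 x) dalpha)).
have [/loewner_le_qform/(_ x) le_sum _] := PE j.
rewrite -qform_scalar; apply: (le_trans le_sum); rewrite addnS qform_sum.
rewrite (eq_bigr (fun i => normsq (phi i *m x))) => [|i _]; last first.
  exact: qform_gram.
by rewrite lerDr posdefmx_ge0 //; apply: info_posdef.
Qed.

Lemma regressor_le : persistently_exciting phi ->
  exists2 beta : K, 0 < beta & forall k x, normsq (phi k *m x) <= beta * normsq x.
Proof.
case=> N [alpha [beta [_ _ beta0 PE]]]; exists beta => // k x.
have [_ /loewner_le_qform/(_ x)] := PE k; rewrite qform_scalar.
apply: le_trans; rewrite qform_sum big_ltn ?ltnS ?leq_addr // qform_gram.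
by rewrite lerDl sumr_ge0 // => i _; rewrite qform_gram normsq_ge0.
Qed.

(** M is chosen above a bound of R and so that lambda M + beta <= M, which makes
    Q <= M invariant under the recursion. *)
Lemma info_le : persistently_exciting phi -> lambda < 1 ->
  exists2 M : K, 0 < M & forall k x, qform (info k) x <= M * normsq x.
Proof.
move=> /regressor_le[beta beta0 le_beta] lambda_lt1.
have [rho rho0 le_rho] := qform_le_normsq R.
pose b := beta / (1 - lambda).
have b0 : 0 < b by rewrite divr_gt0 // subr_gt0.
have bE : beta = (1 - lambda) * b by rewrite mulrC divfK // subr_eq0 gt_eqF.
exists (rho + b) => [|k x]; first exact: addr_gt0.
elim: k => [|k IH].
  by rewrite mulrDl (le_trans (le_rho x)) // lerDl mulr_ge0 ?normsq_ge0 // ltW.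
rewrite qform_infoS.
apply: le_trans (lerD (ler_wpM2l (ltW lambda_gt0) IH) (le_beta k x)) _.
rewrite mulrA -mulrDl ler_wpM2r ?normsq_ge0 // bE.
have : lambda * rho <= rho by rewrite ler_piMl ?(ltW rho0) ?(ltW lambda_lt1).
lra.
Qed.

End Information.

(** * Decay along trajectories *)

Section Decay.
Variables (K : realType) (n : nat) (f : nat -> 'cV[K]_n -> 'cV[K]_n).
Variables (Q : nat -> 'M[K]_n) (lambda c : K).
Hypotheses (lambda_gt0 : 0 < lambda) (c_gt0 : 0 < c).
Hypothesis Q_ge : forall k x, c * normsq x <= qform (Q k) x.
Hypothesis Q_step : forall k x,
  qform (Q k.+1) (f k x) <= lambda * qform (Q k) x.

Lemma energy_decay k0 x : trajectory f k0 x -> forall m,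
  qform (Q (k0 + m)) (x (k0 + m)%N) <= lambda ^+ m * qform (Q k0) (x k0).
Proof.
move=> traj; elim=> [|m IH]; first by rewrite addn0 expr0 mul1r.
rewrite addnS traj ?leq_addr // (le_trans (Q_step _ _)) //.
by rewrite exprS -mulrA ler_pM2l.
Qed.

(** The square root halves the rate: the energy decays like lambda^m, the norm
    like (sqrt lambda)^m. *)
Lemma norm_decay k0 x M : trajectory f k0 x ->
    qform (Q k0) (x k0) <= M * normsq (x k0) -> 0 <= M -> forall m,
  eucl_norm (x (k0 + m)%N)
    <= Num.sqrt (M / c) * eucl_norm (x k0) * Num.sqrt lambda ^+ m.
Proof.
move=> traj leM M0 m; rewrite !eucl_normE.
have Mc0 : 0 <= M / c by rewrite divr_ge0 // ltW.
rewrite -sqrtrX ?(ltW lambda_gt0) // -sqrtrM // -sqrtrM ?(mulr_ge0 Mc0) ?normsq_ge0 //.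
apply: ler_wsqrtr; rewrite -(ler_pM2l c_gt0).
apply: (le_trans (Q_ge (k0 + m) _)).
apply: (le_trans (energy_decay traj m)).
have -> : c * (M / c * normsq (x k0) * lambda ^+ m)
    = lambda ^+ m * (M * normsq (x k0)).
  by field; rewrite gt_eqF.
by rewrite ler_wpM2l // exprn_ge0 // ltW.
Qed.

End Decay.

Theorem theorem6 (K : realType) (n p : nat) (n_gt0 : (0 < n)%N)
    (p_gt0 : (0 < p)%N)
    (phi : nat -> 'M[K]_(p, n)) (phi_pe : persistently_exciting phi)
    (R : 'M[K]_n) (R_posdef : posdefmx R)
    (lambda : K) (lambda_gt0 : 0 < lambda) (lambda_le1 : lambda <= 1)
    (P : nat -> 'M[K]_n)
    (P0 : P 0%N = invmx R)
    (PS : forall k : nat,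
       P k.+1 = lambda^-1 *: P k
                - lambda^-1 *: (P k *m (phi k)^T
                    *m invmx (lambda%:M + phi k *m P k *m (phi k)^T)
                    *m phi k *m P k)) :
  let f := fun (k : nat) (theta : 'cV[K]_n) =>
    (1%:M - P k.+1 *m (phi k)^T *m phi k) *m theta in
  lyapunov_stable f /\
  (lambda < 1 ->
   uniformly_lyapunov_stable f /\ uniformly_globally_geometrically_stable f).
Proof.
move=> f.
have covQ := cov_info R_posdef lambda_gt0 P0 PS.
have [c c0 Q_ge] := info_ge R_posdef lambda_gt0 lambda_le1 phi_pe.
have Q_step k x : qform (info phi R lambda k.+1) (f k x)
    <= lambda * qform (info phi R lambda k) x.
  exact: (energy_step R_posdef lambda_gt0 _ (covQ k.+1)).
have decay := norm_decay lambda_gt0 c0 Q_ge Q_step.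
have sl0 : 0 < Num.sqrt lambda by rewrite sqrtr_gt0.
have sl1 : Num.sqrt lambda <= 1 by rewrite -[leRHS]sqrtr1 ler_wsqrtr.
(* One radius for every start time k0 at which Q_k0 <= M. *)
have small M k0 x (eps : K) : 0 < M -> trajectory f k0 x ->
    qform (info phi R lambda k0) (x k0) <= M * normsq (x k0) ->
    eucl_norm (x k0) < eps / Num.sqrt (M / c) ->
    forall k, (k0 <= k)%N -> eucl_norm (x k) < eps.
  move=> M0 traj leM xsmall k lek; rewrite -(subnKC lek).
  apply: (le_lt_trans (decay _ _ _ traj leM (ltW M0) _)).
  have : Num.sqrt (M / c) * eucl_norm (x k0) < eps.
    by rewrite mulrC -ltr_pdivlMr // sqrtr_gt0 divr_gt0.
  apply: le_lt_trans; rewrite ler_piMr ?mulr_ge0 ?sqrtr_ge0 //.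
  by rewrite exprn_ile1 // ltW.
split.
  move=> eps k0 eps0; have [M M0 leM] := qform_le_normsq (info phi R lambda k0).
  exists (eps / Num.sqrt (M / c)); first by rewrite !(divr_gt0, sqrtr_gt0).
  by move=> x traj xsmall; apply: (small M).
move=> lambda_lt1; have [M M0 leM] := info_le R lambda_gt0 phi_pe lambda_lt1.
split.
  move=> eps eps0.
  exists (eps / Num.sqrt (M / c)); first by rewrite !(divr_gt0, sqrtr_gt0).
  by move=> k0 x traj xsmall; apply: (small M).
exists (Num.sqrt (M / c)), (Num.sqrt lambda)^-1; split.
- by rewrite sqrtr_gt0 divr_gt0.
- by rewrite invf_gt1 // -[ltRHS]sqrtr1 ltr_sqrt.
move=> k0 x traj k lek; rewrite exprVn invrK -{1}(subnKC lek).
exact: decay traj (leM _ _) (ltW M0) _.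
Qed.
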